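(* Let $\mathbb{X}$ be a two-dimensional real polyhedral Banach space. Then there exists an extreme point $z \in E_{\mathbb{X}}$ of the unit ball such that $\beta(z) = J(\mathbb{X})$, i.e., there exist $z\in E_{\mathbb{X}}$ and $y \in S_{\mathbb{X}}$ with $z \perp_{I} y$ and $\beta(z)=\|z + y\| = \|z - y\| = J(\mathbb{X})$.
   Context: $B_{\mathbb{X}}$ and $S_{\mathbb{X}}$ are the closed unit ball and unit sphere of $\mathbb{X}$, and $E_{\mathbb{X}}$ is the set of extreme points of $B_{\mathbb{X}}$. A two-dimensional Banach space is polyhedral if its unit ball has only finitely many extreme points (is a polygon). The James constant is $J(\mathbb{X}) = \sup\{\min\{\|x+y\|, \|x-y\|\} : x, y \in S_{\mathbb{X}}\}$. For $x\in S_{\mathbb{X}}$, the local James constant is $\beta(x) = \sup\{\min\{\|x+y\|, \|x-y\|\} : y\in S_{\mathbb{X}}\}$. Isosceles orthogonality: $x\perp_I y$ means $\|x+y\|=\|x-y\|$. *)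

(* Defs.v *)
From HB Require Import structures.
From mathcomp Require Import all_boot all_order all_algebra.
From mathcomp Require Import all_classical all_reals all_analysis.
Import Order.TTheory GRing.Theory Num.Theory.
Import numFieldNormedType.Exports.
Local Open Scope classical_set_scope.
Local Open Scope ring_scope.

#[short(type="finDimBanachType")]
HB.structure Definition FinDimBanach (R : numFieldType) :=
  {T of CompleteNormedModule R T & Vector R T}.

(* The library's closed_ball is defined as the closure of the open ball; over a
   normed module it is {x | `|x| <= 1} by closed_ballE. *)
Definition unit_ball {R : realType} (X : normedModType R) : set X :=
  closed_ball (0 : X) 1.

Definition unit_sphere {R : realType} (X : normedModType R) : set X :=
  [set x | `|x| = 1].

Definition extreme_points {R : realType} {V : lmodType R} (A : set V) : set V :=
  [set z | A z /\
    forall (x y : V) (t : R), A x -> A y -> 0 < t < 1 ->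
      z = t *: x + (1 - t) *: y -> x = z /\ y = z].

Definition polyhedral {R : realType} (X : normedModType R) : Prop :=
  finite_set (extreme_points (unit_ball X)).

Definition james {R : realType} (X : normedModType R) : R :=
  sup [set Num.min `|x + y| `|x - y|
      | x in unit_sphere X & y in unit_sphere X].

Definition local_james {R : realType} {X : normedModType R} (x : X) : R :=
  sup [set Num.min `|x + y| `|x - y| | y in unit_sphere X].

Definition isosceles_orthogonal {R : realType} {X : normedModType R} (x y : X) : Prop :=
  `|x + y| = `|x - y|.

(* Main.v *)
(** Write m(x, y) = min(|x + y|, |x - y|).  Among the maximizers of m on S x S
    (a compact set) take a pair (x, y) that also maximizes the Euclidean norm of
    its coordinates, so that it is not the midpoint of two other maximizers.
    If neither x nor y were extreme, there would be segments x + s p and y + r q,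
    with p, q nonzero and |s|, |r| <= 1, inside S.  Let f and g support the norm
    at x + y and x - y.  If the linear map (s, r) |-> (f(s p + r q), g(s p - r q))
    is invertible, some small (s, r) makes both coordinates positive and m
    increases; otherwise, for some small (s, r) <> 0 in the kernel, both
    (x, y) +- (s p, r q) are maximizers.  Either way this is a contradiction, so x
    or y is an extreme point z (m is symmetric).  Moving the other vector along
    the arc towards z increases |z + y|, and where |z + y| = |z - y| the pair is
    isosceles orthogonal and still maximizes m. *)
Require Import Defs.
From HB Require Import structures.
From mathcomp Require Import all_boot all_order all_algebra.
From mathcomp Require Import all_classical all_reals all_analysis.
From mathcomp Require Import ring lra.
Import Order.TTheory GRing.Theory Num.Theory.
Import numFieldNormedType.Exports.
Import passmx.
Local Open Scope classical_set_scope.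
Local Open Scope ring_scope.

(** * Supporting functionals and two-by-two linear systems *)

(* One step of the Hahn-Banach extension: if the functional with values m at u
   and a at p is dominated by the norm, b is an admissible value at q. *)
Lemma extend_support {R : realType} {X : normedModType R} (u p q : X) (m a : R) :
    (forall k s : R, k * m + s * a <= `|k *: u + s *: p|) ->
  exists b : R, forall k s r : R,
    k * m + s * a + r * b <= `|k *: u + s *: p + r *: q|.
Proof.
move=> dom.
(* The case [r = -1] forces [b] to bound [low] from above, the case [r = 1] to stay below the values
   in [upP]; homogeneity gives the other [r]. *)
pose low := [set t | exists k s : R, t = k * m + s * a - `|k *: u + s *: p - q|].
have upP k s : ubound low (`|k *: u + s *: p + q| - (k * m + s * a)).
  move=> _ [k' [s' ->]].
  have -> : k *: u + s *: p + q =
      (k + k') *: u + (s + s') *: p - (k' *: u + s' *: p - q).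
    apply: (addIr (k' *: u + s' *: p - q)).
    by rewrite subrK addrACA subrr addr0 addrACA -!scalerDl.
  set w := k' *: u + s' *: p - q.
  have := dom (k + k') (s + s'); set z := (k + k') *: u + _ => domz.
  have : `|z| <= `|z - w| + `|w| by rewrite -{1}(subrK w z) ler_normD.
  nra.
have low_ub : has_ubound low by exists (`|0 *: u + 0 *: p + q| - (0 * m + 0 * a)).
have low0 : low !=set0.
  by exists (0 * m + 0 * a - `|0 *: u + 0 *: p - q|), 0, 0.
exists (sup low) => k s r.
have scale (t : R) (e : X) : 0 < t ->
    `|k *: u + s *: p + t *: e| = t * `|(k / t) *: u + (s / t) *: p + e|.
  move=> t0; rewrite -[X in X * _]gtr0_norm// -normrZ !scalerDr !scalerA.
  by rewrite !(mulrC t) !divfK ?gt_eqF.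
have scaleE (t : R) : 0 < t -> t * (k / t * m + s / t * a) = k * m + s * a.
  by move=> t0; field; rewrite gt_eqF.
have [r0|r0|->] := ltrgt0P r.
- have : sup low <= `|(k / r) *: u + (s / r) *: p + q| - (k / r * m + s / r * a).
    exact: ge_sup.
  rewrite scale// -(ler_pM2l r0) mulrBr scaleE//; lra.
- have nr0 : 0 < - r by rewrite oppr_gt0.
  rewrite -[r in r *: q]opprK scaleNr -scalerN scale//.
  have : k / - r * m + s / - r * a - `|(k / - r) *: u + (s / - r) *: p - q|
     <= sup low by apply: ub_le_sup => //; exists (k / - r), (s / - r).
  rewrite -(ler_pM2l nr0) mulrBr scaleE//; lra.
- by rewrite mul0r scale0r !addr0.
Qed.

(** A functional dominated by the norm, with value |u| at [u], is extended from the line of [u] to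
    [p] and then to [q]; [a] and [b] are its values there. *)
Lemma exists_subgradient {R : realType} {X : normedModType R} (u p q : X) :
  exists a b : R, forall s r : R, `|u| + s * a + r * b <= `|u + s *: p + r *: q|.
Proof.
have [|a da] := @extend_support R X u 0 p `|u| 0.
  by move=> k s; rewrite scaler0 mulr0 !addr0 normrZ ler_wpM2r ?ler_norm.
have [|b db] := @extend_support R X u p q `|u| a.
  by move=> k s; have := da k 0 s; rewrite scaler0 mulr0 !addr0.
by exists a, b => s r; have := db 1 s r; rewrite mul1r scale1r.
Qed.

(** If the determinant is nonzero, both forms can be given the value 1. Otherwise [(b, - a)] and
    [(d, - c)] lie in the kernel, and so does [(1, 0)] when both vanish. Division by 1 + |s| + |r|
    preserves either alternative and gives the bounds. *)
Lemma linear_system_dichotomy {R : realFieldType} (a b c d : R) :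
  exists s r : R, [/\ `|s| <= 1, `|r| <= 1 &
    (0 < s * a + r * b /\ 0 < s * c + r * d) \/
    [/\ (s != 0) || (r != 0), s * a + r * b = 0 & s * c + r * d = 0]].
Proof.
suff [s [r H]] : exists s r : R,
    (0 < s * a + r * b /\ 0 < s * c + r * d) \/
    [/\ (s != 0) || (r != 0), s * a + r * b = 0 & s * c + r * d = 0].
  have t0 : 0 < 1 + `|s| + `|r| by rewrite !ltr_wpDr.
  exists (s / (1 + `|s| + `|r|)), (r / (1 + `|s| + `|r|)).
  have s0 := normr_ge0 s; have r0 := normr_ge0 r.
  split.
  - by rewrite normrM normfV (gtr0_norm t0) ler_pdivrMr//; lra.
  - by rewrite normrM normfV (gtr0_norm t0) ler_pdivrMr//; lra.
  - have E x y : s / (1 + `|s| + `|r|) * x + r / (1 + `|s| + `|r|) * y =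
        (s * x + r * y) / (1 + `|s| + `|r|) by field; rewrite gt_eqF.
    rewrite !E; case: H => [[H1 H2]|[H1 -> ->]]; [left|right].
      by rewrite !divr_gt0.
    by rewrite mul0r !mulf_eq0 invr_eq0 (gt_eqF t0) !orbF.
have [det0|det_neq0] := eqVneq (a * d - b * c) 0; last first.
  exists ((d - b) / (a * d - b * c)), ((a - c) / (a * d - b * c)); left.
  have -> : (d - b) / (a * d - b * c) * a + (a - c) / (a * d - b * c) * b = 1.
    by field.
  have -> : (d - b) / (a * d - b * c) * c + (a - c) / (a * d - b * c) * d = 1.
    by field.
  by [].
have [ab0|ab_neq0] := boolP ((b != 0) || (- a != 0)).
  by exists b, (- a); right; split=> //; lra.
have [cd0|cd_neq0] := boolP ((d != 0) || (- c != 0)).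
  by exists d, (- c); right; split=> //; lra.
move: ab_neq0 cd_neq0.
rewrite !negb_or !negbK !oppr_eq0 => /andP[/eqP b0 /eqP a0].
move=> /andP[/eqP d0 /eqP c0].
by exists 1, 0; right; rewrite oner_neq0; split=> //; lra.
Qed.

(** * Geometry of the unit sphere *)

(* The triangle inequality at the point where the segment from [-z] to
   [a *: y + b *: z] meets the ray through [y], cleared of denominators. *)
Lemma norm_add_arc {R : realType} {X : normedModType R} (y z : X) (a b : R) :
    0 <= a -> 0 <= b -> `|y| = 1 -> `|z| = 1 -> `|a *: y + b *: z| = 1 ->
  `|z + y| <= `|z + (a *: y + b *: z)|.
Proof.
set w := a *: y + b *: z => a0 b0 y1 z1 w1.
have b1 : 0 < 1 + b by lra.
have zyE : (1 + b) *: (z + y) = (z + w) + (1 + b - a) *: y.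
  rewrite scalerBl /w [z + (_ + _)]addrCA [RHS]addrC addrA subrK [RHS]addrC.
  by rewrite scalerDr [in LHS]scalerDl scale1r.
have wE : (1 + b) *: w = b *: (z + w) + a *: y.
  by rewrite scalerDl scale1r [b *: (z + w)]scalerDr {1}/w -[LHS]addrA [LHS]addrC.
have ay : a *: y = w - b *: z by rewrite addrK.
(* This makes the coefficient of [y] in [zyE] nonnegative. *)
have ab : a <= 1 + b.
  have := ler_normB w (b *: z).
  by rewrite -ay !normrZ y1 z1 w1 !mulr1 !ger0_norm.
have := ler_normD (z + w) ((1 + b - a) *: y).
have := ler_normD (b *: (z + w)) (a *: y).
rewrite -zyE -wE !normrZ y1 w1 !mulr1 (gtr0_norm b1) !ger0_norm ?subr_ge0//.
(* [h1] bounds 1 + b - a by b |z + w|, which absorbs the last term of [h2]. *)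
move=> h1 h2; rewrite -(ler_pM2l b1); lra.
Qed.

(** A short piece, centred at [x], of a segment of the ball stays in the ball by convexity. Its
    opposite points average to [x], of norm 1, so neither has norm below 1. *)
Lemma not_extreme_sphere {R : realType} {X : normedModType R} (x : X) :
    `|x| = 1 -> ~ extreme_points (unit_ball X) x ->
  exists2 p : X, p != 0 & forall s : R, `|s| <= 1 -> `|x + s *: p| = 1.
Proof.
move=> x1 nx.
have ballE (v : X) : unit_ball X v <-> `|v| <= 1.
  by rewrite /unit_ball closed_ballE// /closed_ball_ /= sub0r normrN.
have [a [b [t [/ballE a1 /ballE b1 /andP[t0 t1] xE ab]]]] :
    exists a b t, [/\ unit_ball X a, unit_ball X b, 0 < t < 1,
      x = t *: a + (1 - t) *: b & a != b].
  apply: contrapT => h; apply: nx; split; first by apply/ballE; rewrite x1.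
  move=> a b t Ba Bb t01 xE; have [ab|ab] := eqVneq a b; last first.
    by exfalso; apply: h; exists a, b, t.
  by subst b; rewrite -scalerDl addrC subrK scale1r in xE.
(* The largest [e] for which both weights t + s e and 1 - (t + s e) stay nonnegative whenever |s| <=
   1. *)
pose e := Num.min t (1 - t).
have e0 : 0 < e by rewrite lt_min t0 subr_gt0.
have ball_le (s : R) : `|s| <= 1 -> `|x + s *: (e *: (a - b))| <= 1.
  rewrite ler_norml => /andP[s1 s2].
  have -> : x + s *: (e *: (a - b)) = (t + s * e) *: a + (1 - (t + s * e)) *: b.
    rewrite xE scalerA scalerBr opprD [1 + (_ + _)]addrA [(t + s * e) *: a]scalerDl.
    by rewrite [(1 - t - s * e) *: b]scalerDl scaleNr [RHS]addrACA.
  have et : e <= t by rewrite ge_min lexx.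
  have et1 : e <= 1 - t by rewrite ge_min lexx orbT.
  have c0 : 0 <= t + s * e by nra.
  have c1 : 0 <= 1 - (t + s * e) by nra.
  apply: le_trans (ler_normD _ _) _; rewrite !normrZ !ger0_norm//; nra.
exists (e *: (a - b)); first by rewrite scaler_eq0 gt_eqF//= subr_eq0.
move=> s s1; apply/eqP; rewrite eq_le ball_le//=.
have : `|x + s *: (e *: (a - b)) + (x + (- s) *: (e *: (a - b)))| = 2.
  by rewrite addrACA -scalerDl subrr scale0r addr0 -mulr2n normrMn x1.
have := ball_le (- s); rewrite normrN => /(_ s1).
have := ler_normD (x + s *: (e *: (a - b))) (x + (- s) *: (e *: (a - b))).
lra.
Qed.

(** * Compactness in coordinates and isolated maximizers *)

Lemma linear_rV_continuous {R : realType} {X : normedModType R} {n : nat}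
  (f : {linear 'rV[R]_n -> X}) : continuous f.
Proof.
have -> : f = (fun c => \sum_(i < n) c 0 i *: f (delta_mx 0 i)) :> (_ -> _).
  by apply/funext => c; rewrite [in LHS](row_sum_delta c) linear_sum;
    apply: eq_bigr => i _; rewrite linearZ.
apply: continuous_big => [|i _ c]; first exact: add_continuous.
by apply: (@cvgZr_tmp _ _ _ (nbhs c)); exact: coord_continuous.
Qed.

(** By injectivity |f| has a positive minimum on the unit sphere of row vectors; its inverse bounds
    every [c] with |f c| = 1. *)
Lemma linear_rV_sphere_compact {R : realType} {X : normedModType R} {n : nat}
  (f : {linear 'rV[R]_n -> X}) : injective f -> compact [set c | `|f c| = 1].
Proof.
move=> inj_f.
have cont_nf : continuous (fun c => `|f c|).
  move=> c; apply: (@cvg_comp _ _ _ f Num.norm); last exact: norm_continuous.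
  exact: linear_rV_continuous.
apply: bounded_closed_compact; last first.
  apply: (@preimage_closed _ _ _ [set 1 : R]) => [c _|]; first exact: cont_nf.
  exact: closed_eq.
pose U := [set c : 'rV[R]_n | `|c| = 1].
have cU : compact U.
  apply: bounded_closed_compact.
    by exists 1; split=> // M M1 c /= ->; exact: ltW.
  apply: (@preimage_closed _ _ _ [set 1 : R]) => [c _|]; first exact: norm_continuous.
  exact: closed_eq.
have f_neq0 c : c != 0 -> 0 < `|f c|.
  by rewrite normr_gt0; apply: contra_neq => fc0; apply: inj_f; rewrite linear0.
have normalize c : c != 0 -> U (`|c|^-1 *: c).
  by move=> c0; rewrite /U /= normrZ normfV normr_id mulVf ?normr_eq0.
have [U0|/set0P/negP/negPn/eqP U0] := pselect (U !=set0); last first.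
  (* With [U] empty, the zero row vector is the only one. *)
  exists 0; split=> // M M0 c _ /=; have [->|c0] := eqVneq c 0.
    by rewrite normr0 ltW.
  by have := normalize _ c0; rewrite U0.
have [|c0 Uc0 c0_min] := compact_EVT_min U0 cU (f := fun c => `|f c|).
  exact: continuous_subspaceT.
have m0 : 0 < `|f c0|.
  by apply: f_neq0; rewrite -normr_gt0 (set_mem Uc0).
exists (`|f c0|^-1); split=> [|M Mm c /= fc1]; first exact: num_real.
apply: le_trans (ltW Mm); rewrite /=; have [->|c_neq0] := eqVneq c 0.
  by rewrite normr0 invr_ge0.
have := c0_min _ (mem_set (normalize _ c_neq0)).
rewrite linearZ normrZ normfV normr_id fc1 mulr1 => h.
by rewrite -[leLHS]invrK lef_pV2// posrE invr_gt0 normr_gt0.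
Qed.

(** The Euclidean norm of the coordinates breaks ties because it obeys the parallelogram law, which
    the norm of [X] need not do. *)
Lemma exists_isolated_maximizer {R : realType} {X : finDimBanachType R}
    (F : X * X -> R) : continuous F -> unit_sphere X !=set0 ->
  exists x y : X, [/\ unit_sphere X x, unit_sphere X y,
    forall u v, unit_sphere X u -> unit_sphere X v -> F (u, v) <= F (x, y) &
    forall p q : X,
      (forall e : R, `|e| = 1 -> [/\ unit_sphere X (x + e *: p),
        unit_sphere X (y + e *: q) & F (x, y) <= F (x + e *: p, y + e *: q)]) ->
      p = 0 /\ q = 0].
Proof.
move=> cF [x0 x01].
pose n : nat := \dim {:X}; pose bs := vbasis {:X}.
pose L : {linear 'rV[R]_n -> X} := vecof bs.
pose L' : X -> 'rV[R]_n := rVof bs.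
have LK : cancel L' L := rVofK (vbasisP {:X}).
have inj_L : injective L := can_inj (vecofK (vbasisP {:X})).
have cL := linear_rV_continuous L.
pose S := [set c | `|L c| = 1].
have cS : compact S by exact: linear_rV_sphere_compact.
pose G (c : 'rV[R]_n * 'rV[R]_n) := F (L c.1, L c.2).
have cG : continuous G.
  move=> c; apply: (@cvg_comp _ _ _ (fun c => (L c.1, L c.2)) F); last exact: cF.
  apply: cvg_pair => /=.
    by apply: (@cvg_comp _ _ _ fst L); [exact: cvg_fst|exact: cL].
  by apply: (@cvg_comp _ _ _ snd L); [exact: cvg_snd|exact: cL].
have [|||c1 Sc1 c1_max] := @compact_EVT_max _ _ G (S `*` S).
- by exists (L' x0, L' x0);
    split; rewrite /S /= LK.
- exact: compact_setX.
- exact: continuous_subspaceT.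
pose M := (S `*` S) `&` [set c | G c1 <= G c].
have cM : compact M.
  apply: compact_closedI; first exact: compact_setX.
  apply: (@preimage_closed _ _ G [set r | G c1 <= r]) => [c _|]; first exact: cG.
  exact: closed_ge.
pose sq (c : 'rV[R]_n) := \sum_(i < n) c 0 i * c 0 i.
have csq : continuous sq.
  apply: continuous_big => [|i _ c]; first exact: add_continuous.
  by apply: (@cvgM _ _ (nbhs c)); exact: coord_continuous.
pose Q (c : 'rV[R]_n * 'rV[R]_n) := sq c.1 + sq c.2.
have cQ : continuous Q.
  move=> c; apply: cvgD.
    by apply: (@cvg_comp _ _ _ fst sq); [exact: cvg_fst|exact: csq].
  by apply: (@cvg_comp _ _ _ snd sq); [exact: cvg_snd|exact: csq].
have [|||c2 /set_mem[[Sx Sy] c2_ge] c2_max] := @compact_EVT_max _ _ Q M.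
- by exists c1; split; [exact: set_mem|exact: lexx].
- exact: cM.
- exact: continuous_subspaceT.
exists (L c2.1), (L c2.2); split=> // [u v u1 v1|p q pq].
  apply: le_trans c2_ge.
  have := c1_max (L' u, L' v).
  rewrite /G /= !LK; apply; apply/mem_set.
  by split; rewrite /S /= LK.
pose a := L' p; pose b := L' q.
have maxQ (e : R) : `|e| = 1 -> Q (c2.1 + e *: a, c2.2 + e *: b) <= Q c2.
  move=> e1; apply/c2_max/mem_set.
  have La : L (c2.1 + e *: a) = L c2.1 + e *: p by rewrite linearD linearZ /= LK.
  have Lb : L (c2.2 + e *: b) = L c2.2 + e *: q by rewrite linearD linearZ /= LK.
  have [h1 h2 h3] := pq e e1.
  split; first by split; rewrite /S /= ?La ?Lb.
  by rewrite /= /G /= La Lb; exact: le_trans c2_ge h3.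
have sqE (c v : 'rV[R]_n) : sq (c + v) + sq (c - v) = 2 * sq c + 2 * sq v.
  rewrite /sq -big_split /= !mulr_sumr -big_split; apply: eq_bigr => i _ /=.
  by rewrite !mxE; ring.
have sq_ge0 v : 0 <= sq v by apply: sumr_ge0 => i _; rewrite -expr2 sqr_ge0.
have sq_eq0 v : sq v = 0 -> v = 0.
  move=> /eqP; rewrite psumr_eq0 => [/allP v0|i _]; last by rewrite -expr2 sqr_ge0.
  apply/rowP => i; rewrite mxE; apply/eqP; rewrite -sqrf_eq0 expr2.
  by apply: (implyP (v0 i _)); rewrite ?mem_index_enum.
(* Summing the bounds for both signs, the parallelogram law cancels [Q c2] and leaves
   [sq a + sq b <= 0]. *)
have := maxQ 1 (normr1 _); have := maxQ (- 1); rewrite normrN normr1 => /(_ erefl).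
rewrite /Q /= !scaleN1r !scale1r => h1 h2.
have := sqE c2.1 a; have := sqE c2.2 b; have := sq_ge0 a; have := sq_ge0 b.
move=> b0 a0 h3 h4.
have /sq_eq0 a_eq0 : sq a = 0 by lra.
have /sq_eq0 b_eq0 : sq b = 0 by lra.
by rewrite -(LK p) -(LK q) -/a -/b a_eq0 b_eq0 !linear0.
Qed.

(** * Maximizing pairs with an extreme point *)

Definition min_sum_diff {R : realType} {X : normedModType R} (x y : X) : R :=
  Num.min `|x + y| `|x - y|.

Lemma min_sum_diffC {R : realType} {X : normedModType R} (x y : X) :
  min_sum_diff x y = min_sum_diff y x.
Proof. by rewrite /min_sum_diff addrC distrC. Qed.

Lemma min_sum_diff_oppr {R : realType} {X : normedModType R} (x y : X) :
  min_sum_diff x (- y) = min_sum_diff x y.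
Proof. by rewrite /min_sum_diff opprK minC. Qed.

Lemma min_sum_diff_continuous {R : realType} {X : normedModType R} :
  continuous (fun c : X * X => min_sum_diff c.1 c.2).
Proof.
move=> c; rewrite /min_sum_diff.
apply: (@continuous_min _ _ (fun c : X * X => `|c.1 + c.2|) (fun c => `|c.1 - c.2|)).
  apply: (@cvg_comp _ _ _ (fun c : X * X => c.1 + c.2) Num.norm).
    by apply: cvgD; [exact: cvg_fst|exact: cvg_snd].
  exact: norm_continuous.
apply: (@cvg_comp _ _ _ (fun c : X * X => c.1 - c.2) Num.norm).
  by apply: cvgB; [exact: cvg_fst|exact: cvg_snd].
exact: norm_continuous.
Qed.

Lemma extreme_maximizer {R : realType} {X : finDimBanachType R} :
    unit_sphere X !=set0 ->
  exists z y : X, [/\ extreme_points (unit_ball X) z, unit_sphere X z, unit_sphere X y &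
    forall u v, unit_sphere X u -> unit_sphere X v ->
      min_sum_diff u v <= min_sum_diff z y].
Proof.
move=> /(exists_isolated_maximizer _ min_sum_diff_continuous).
move=> [x [y [/= x1 y1 max_xy isolated]]].
have [ex|nx] := pselect (extreme_points (unit_ball X) x); first by exists x, y.
have [ey|ny] := pselect (extreme_points (unit_ball X) y).
  by exists y, x; split=> // u v u1 v1; rewrite (min_sum_diffC y); exact: max_xy.
exfalso.
have [p p0 xp] := not_extreme_sphere _ x1 nx.
have [q q0 yq] := not_extreme_sphere _ y1 ny.
have [a [b ab]] := exists_subgradient (x + y) p q.
(* Moving [y] along [q] moves [x - y] along [- q]. *)
have [c [d cd]] := exists_subgradient (x - y) p (- q).
have sumE s r : x + s *: p + (y + r *: q) = x + y + s *: p + r *: q.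
  by rewrite addrACA addrA.
have diffE s r : x + s *: p - (y + r *: q) = x - y + s *: p + r *: - q.
  by rewrite opprD addrACA addrA scalerN.
have [s [r [s1 r1 [[h1 h2]|[sr0 h1 h2]]]]] := linear_system_dichotomy a b c d.
  (* Both norms grow strictly by the subgradient bounds, against maximality. *)
  have := max_xy _ _ (xp _ s1) (yq _ r1); apply/negP; rewrite -ltNge.
  rewrite /min_sum_diff sumE diffE lt_min !gt_min.
  have := ab s r; have := cd s r => h3 h4.
  by apply/andP; split; apply/orP; [left|right]; lra.
(* Both subgradient bounds are constant along this direction, so neither norm drops for either sign
   and isolation applies. *)
have [|/eqP sp /eqP rq] := isolated (s *: p) (r *: q).
  move=> e e1; rewrite !scalerA.
  have es : `|e * s| <= 1 by rewrite normrM e1 mul1r.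
  have er : `|e * r| <= 1 by rewrite normrM e1 mul1r.
  split; [exact: xp|exact: yq|].
  rewrite /min_sum_diff sumE diffE le_min !ge_min.
  have := ab (e * s) (e * r); have := cd (e * s) (e * r).
  rewrite -!addrA -!mulrA -!mulrDr h1 h2 !mulr0 !addr0 => -> ->.
  by rewrite orbT.
by move: sr0 sp rq; rewrite !scaler_eq0 (negbTE p0) (negbTE q0) !orbF => /orP[]/negbTE ->.
Qed.

(** * From a maximizing pair to an isosceles orthogonal one *)

(** Along the normalized segment from [y] to [z], the difference |z + w| - |z - w| starts
    nonpositive, up to the sign of [y], and ends positive. At a zero, [norm_add_arc] shows that |z +
    w| has not decreased. *)
Lemma isosceles_improvement {R : realType} {X : normedModType R} (z y : X) :
    unit_sphere X z -> unit_sphere X y -> 0 < min_sum_diff z y ->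
  exists w : X, [/\ unit_sphere X w, isosceles_orthogonal z w &
    min_sum_diff z y <= `|z + w|].
Proof.
move=> z1.
wlog le_zy : y / `|z + y| <= `|z - y| => [hw y1 zy0|y1 zy0].
  have [le_zy|/ltW le_zy] := leP `|z + y| `|z - y|; first exact: hw.
  have [|||w [w1 zw w_ge]] := hw (- y); rewrite ?min_sum_diff_oppr ?opprK//.
    by rewrite /unit_sphere /= normrN.
  by exists w; rewrite min_sum_diff_oppr in w_ge.
have zy_neq0 : 0 < `|z + y|.
  by move: zy0; rewrite /min_sum_diff (min_idPl le_zy).
pose f (t : R) : X := (1 - t) *: y + t *: z.
have cf : continuous f.
  move=> t; apply: cvgD; apply: cvgZr_tmp; last exact: cvg_id.
  by apply: cvgB; [exact: cvg_cst|exact: cvg_id].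
(* Scaling [z] by |f t|, instead of normalizing [f t], keeps [G] continuous even where [f] might
   vanish. *)
pose G (t : R) := `| `|f t| *: z + f t | - `| `|f t| *: z - f t |.
have cG : continuous G.
  have cnf : continuous (fun t => `|f t|).
    by move=> t; apply: (@cvg_comp _ _ _ f Num.norm); [exact: cf|exact: norm_continuous].
  have cz : continuous (fun t => `|f t| *: z).
    by move=> t; apply: cvgZr_tmp; exact: cnf.
  move=> t; apply: cvgB.
    apply: (@cvg_comp _ _ _ (fun t => `|f t| *: z + f t) Num.norm).
      by apply: cvgD; [exact: cz|exact: cf].
    exact: norm_continuous.
  apply: (@cvg_comp _ _ _ (fun t => `|f t| *: z - f t) Num.norm).
    by apply: cvgB; [exact: cz|exact: cf].
  exact: norm_continuous.
have f0 : f 0 = y by rewrite /f subr0 scale1r scale0r addr0.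
have f1 : f 1 = z by rewrite /f subrr scale1r scale0r add0r.
have [|||t] := @IVT R G 0 1 0; first exact: ler01.
- exact: continuous_subspaceT.
- rewrite /G f0 f1 y1 z1 !scale1r subrr normr0 subr0 ge_min le_max.
  by rewrite subr_le0 le_zy normr_ge0 orbT.
rewrite in_itv /= => /andP[t0 t1] /eqP; rewrite subr_eq0 => /eqP Gt.
(* [f t = 0] would force [t = 1 - t], hence [y = - z], against |z + y| > 0. *)
have ft_neq0 : 0 < `|f t|.
  rewrite normr_gt0; apply/eqP => ft0.
  have tE : (1 - t) *: y = - (t *: z) by apply/eqP; rewrite -addr_eq0; apply/eqP.
  have := congr1 Num.norm tE.
  rewrite normrN !normrZ y1 z1 !mulr1 !ger0_norm ?subr_ge0// => tt.
  move: tE; rewrite tt -scalerN => /scalerI yz.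
  by move: zy_neq0; rewrite yz ?subrr ?normr0 ?ltxx//; apply/eqP; lra.
have ftV (s : X) : `|f t| *: (`|f t|^-1 *: s) = s.
  by rewrite scalerA mulfV ?scale1r// gt_eqF.
pose w := `|f t|^-1 *: f t.
have w1 : `|w| = 1 by rewrite normrZ normfV normr_id mulVf// gt_eqF.
have wE : w = ((1 - t) / `|f t|) *: y + (t / `|f t|) *: z.
  by rewrite /w [in X in _ *: X]/f scalerDr !scalerA !(mulrC _^-1).
exists w; split=> //.
  have normE (s : X) : `|f t| * `|s| = `| `|f t| *: s | by rewrite normrZ normr_id.
  by apply: (mulfI (lt0r_neq0 ft_neq0)); rewrite !normE scalerDr scalerBr ftV.
rewrite /min_sum_diff ge_min wE; apply/orP; left.
by apply: norm_add_arc; rewrite -?wE// divr_ge0// subr_ge0.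
Qed.

(** This makes the maximum of [min_sum_diff] positive, as [isosceles_improvement] requires; on the
    sphere it vanishes only at equal or opposite vectors. *)
Lemma sphere_pair_not_parallel {R : realType} {X : finDimBanachType R} :
    (1 < \dim {:X})%N ->
  exists x y : X, [/\ unit_sphere X x, unit_sphere X y & 0 < min_sum_diff x y].
Proof.
move=> dimX; pose x := vpick {:X}.
have x0 : x != 0 by rewrite vpick0 -dimv_eq0 -lt0n ltnW.
have [v vx] : exists v, v \notin <[x]>%VS.
  apply: contrapT => all_x.
  have : (\dim {:X} <= \dim <[x]>)%N.
    apply/dimvS/subvP => v _; apply/negPn/negP => vx.
    by apply: all_x; exists v.
  by rewrite dim_vline x0 leqNgt dimX.
have v0 : v != 0 by apply: contraNneq vx => ->; exact: mem0v.
have unit_normalize (s : X) : s != 0 -> unit_sphere X (`|s|^-1 *: s).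
  by move=> s0; rewrite /unit_sphere /= normrZ normfV normr_id mulVf// normr_eq0.
exists (`|x|^-1 *: x), (`|v|^-1 *: v); split; [exact: unit_normalize..|].
have vE : v = `|v| *: (`|v|^-1 *: v) by rewrite scalerA mulfV ?scale1r ?normr_eq0.
have lineP (k : R) : `|v|^-1 *: v <> k *: x.
  by move=> vk; move/negP: vx; apply; rewrite vE vk scalerA; apply/vlineP; eexists.
rewrite /min_sum_diff lt_min !normr_gt0 subr_eq0 addr_eq0.
apply/andP; split; apply/eqP => /esym; last exact: lineP.
by move=> h; apply: (lineP (- `|x|^-1)); rewrite scaleNr -h opprK.
Qed.

Theorem theorem2p13 (R : realType) (X : finDimBanachType R)
    (dimX : \dim {:X} = 2%N) (polyX : polyhedral X) :
  exists z y : X,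
    [/\ extreme_points (unit_ball X) z,
        unit_sphere X y,
        isosceles_orthogonal z y &
        [/\ local_james z = `|z + y|, `|z + y| = `|z - y|
          & `|z - y| = james X]].
Proof.
have [|u [v [u1 v1 uv0]]] := @sphere_pair_not_parallel R X; first by rewrite dimX.
have [|z [y [z_ext z1 y1 zy_max]]] := @extreme_maximizer R X; first by exists u.
have zy0 : 0 < min_sum_diff z y := lt_le_trans uv0 (zy_max _ _ u1 v1).
have [w [w1 zw w_ge]] := isosceles_improvement _ _ z1 y1 zy0.
have minE : min_sum_diff z w = `|z + w| by rewrite /min_sum_diff -zw minxx.
have w_max a b : unit_sphere X a -> unit_sphere X b -> min_sum_diff a b <= `|z + w|.
  by move=> a1 b1; apply: le_trans (zy_max _ _ a1 b1) w_ge.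
(* |z + w| bounds [min_sum_diff] on all unit pairs and is attained at [(z, w)], so it equals both
   suprema. *)
exists z, w; split=> //; split=> //.
- apply/eqP; rewrite eq_le; apply/andP; split.
    by apply: ge_sup; [exists (min_sum_diff z w), w|move=> _ [b b1 <-]; exact: w_max].
  rewrite -minE; apply: ub_le_sup; last by exists w.
  by exists `|z + w| => _ [b b1 <-]; exact: w_max.
- rewrite -zw; apply/eqP; rewrite eq_le; apply/andP; split.
    rewrite -minE; apply: ub_le_sup; last by exists z => //; exists w.
    by exists `|z + w| => _ [a a1 [b b1 <-]]; exact: w_max.
  apply: ge_sup; first by exists (min_sum_diff z w), z => //; exists w.
  by move=> _ [a a1 [b b1 <-]]; exact: w_max.
Qed.
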